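(* Let $(X,d,\mu)$ be a metric measure space with doubling measure $\mu$, let $1<p\le q<\infty$ and $\alpha\in[0,1/q)$. Then there exists a positive constant $C$, depending on $\alpha$, $p$ and $q$, such that, for all $f\in\mathcal{M}_p^q(X)$, $$\|M_\alpha f\|_{\mathcal{M}_{\widetilde p}^{\widetilde q}(X)}\le C\|f\|_{\mathcal{M}_p^q(X)},$$ where $\widetilde p:=\frac{p}{1-\alpha q}$ and $\widetilde q:=\frac{q}{1-\alpha q}$.
   Context: Throughout, $(X,d,\mu)$ is a metric space with a non-trivial Borel regular measure $\mu$ which is finite on bounded sets and positive on (non-empty) open sets. $\mu$ is doubling if there is $C_0\in[1,\infty)$ with $\mu(B(x,2r))\le C_0\mu(B(x,r))$ for all $x\in X$, $r>0$. Morrey space: for $1\le p\le q<\infty$, $\mathcal{M}_p^q(X)$ is the space of all measurable functions $f$ on $X$ with $$\|f\|_{\mathcal{M}_p^q(X)}:=\sup_{B\subset X}[\mu(B)]^{1/q-1/p}\left[\int_B|f(x)|^p\,d\mu(x)\right]^{1/p}<\infty,$$ the supremum being over all balls $B$ in $X$. For $\alpha\in[0,1]$, $f\in L^1_{\mathrm{loc}}(X)$ and $x\in X$, $$M_\alpha f(x):=\sup_{r>0}[\mu(B(x,r))]^{\alpha-1}\int_{B(x,r)}|f(y)|\,d\mu(y).$$ *)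

(* Defs.v *)
From HB Require Import structures.
From mathcomp Require Import all_boot all_order all_algebra.
From mathcomp Require Import all_classical all_reals all_analysis measurable_realfun.

Set Implicit Arguments.
Unset Strict Implicit.
Unset Printing Implicit Defensive.

Import Order.TTheory GRing.Theory Num.Theory.
Import numFieldNormedType.Exports.

Local Open Scope classical_set_scope.
Local Open Scope ring_scope.
Local Open Scope ereal_scope.

(* Measurable types are pointed, so metric spaces have to be pointed as well;
   this only excludes the empty space, which carries no non-trivial measure. *)
#[short(type="pmetricType")]
HB.structure Definition PointedMetric (R : numDomainType) :=
  {X of Metric R X & Pointed X}.

Section MetricMeasure.
Context (R : realType) (X : pmetricType R).

Definition borel_set (A : set X) : Prop := <<s [set U : set X | open U] >> A.

Definition metric_bounded (A : set X) : Prop :=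
  exists M : R, forall x y, A x -> A y -> (mdist x y <= M)%R.

(* As usual in geometric measure theory, a measure is defined on all subsets
   of X, i.e. it is an outer measure; its measurable sets are the Caratheodory
   measurable ones. *)
Definition borel_regular (mu : {outer_measure set X -> \bar R}) : Prop :=
  (forall A, borel_set A -> mu.-caratheodory A) /\
  (forall A : set X, exists B, [/\ borel_set B, A `<=` B & mu A = mu B]).

Record metric_measure_space (mu : {outer_measure set X -> \bar R}) : Prop := {
  mms_borel_regular : borel_regular mu ;
  mms_nontrivial : mu [set: X] != 0 ;
  mms_bounded : forall A : set X, metric_bounded A -> mu A < +oo ;
  mms_open : forall U : set X, open U -> U !=set0 -> 0 < mu U
}.

Definition doubling (mu : {outer_measure set X -> \bar R}) : Prop :=
  exists C0 : R, (1 <= C0)%R /\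
    forall (x : X) (r : R), (0 < r)%R ->
      mu (ball x (2 * r)) <= C0%:E * mu (ball x r).

Definition balls : set (set X) :=
  [set B | exists x : X, exists2 r : R, (0 < r)%R & B = ball x r].

Section Morrey.
Variable mu : {outer_measure set X -> \bar R}.

(* X with the sigma-algebra of mu-measurable sets, on which mu is a measure *)
Local Notation T := (caratheodory_type mu).
Local Notation mu' := (mu : set (caratheodory_type mu) -> \bar R).

Definition morrey_norm (p q : R) (f : T -> \bar R) : \bar R :=
  ereal_sup [set mu' B `^ (q^-1 - p^-1) *
                 (\int[mu']_(x in B) (`|f x| `^ p)) `^ (p^-1) | B in balls].

Definition morrey_space (p q : R) : set (T -> \bar R) :=
  [set f | measurable_fun [set: T] f /\ morrey_norm p q f < +oo].

Definition frac_maximal (alpha : R) (f : T -> \bar R) : T -> \bar R :=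
  fun x => ereal_sup [set mu' (ball (x : X) r) `^ (alpha - 1) *
                          \int[mu']_(y in ball (x : X) r) `|f y|
                     | r in [set r : R | (0 < r)%R]].

End Morrey.
End MetricMeasure.

(* Main.v *)
Require Import Defs.
From HB Require Import structures.
From mathcomp Require Import all_boot all_order all_algebra.
From mathcomp Require Import all_classical all_reals all_analysis measurable_realfun.
From mathcomp Require Import finmap ring lra.

Set Implicit Arguments.
Unset Strict Implicit.
Unset Printing Implicit Defensive.

Import Order.TTheory GRing.Theory Num.Theory.
Import numFieldNormedType.Exports.

Local Open Scope classical_set_scope.
Local Open Scope ring_scope.

(** The theorem combines a pointwise interpolation with the boundedness on
    [M_p^q] of the Hardy-Littlewood operator [M] (the case [alpha = 0]).

    Interpolation, [frac_maximal_le_maximal].  Let [N] bound the Morrey norm of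
    [f], and let [m] be the measure of a ball and [I] the integral of [|f|] over
    it.  The mean [I / m] is at most [M f], and the Morrey condition bounds
    [m ^ (1/q - 1) I] by [2 N] ([morrey_mean_le]).  Since
    [m ^ (alpha - 1) I = (I / m) ^ (1 - alpha q) (m ^ (1/q - 1) I) ^ (alpha q)],
    one gets [M_alpha f <= (2 N) ^ (alpha q) (M f) ^ (1 - alpha q)].  The
    exponents [p / (1 - alpha q)] and [q / (1 - alpha q)] are exactly those for
    which raising this to the power and integrating over a ball turns the Morrey
    estimate for [M f] into the one for [M_alpha f].

    Boundedness of [M], [maximal_poweR_integral_le].  On a ball [B] of radius [r]
    and measure [m], the means of [|f|] over balls that are centred in [B] and
    have radius above [r] are at most [l = 2 C0 N m ^ (- 1/q)], again by
    [morrey_mean_le] and doubling.  So at levels [t >= l] only balls of radius at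
    most [r] matter ([large_mean_radius_le]); these lie in [2B], and Vitali's
    covering lemma [vitali_covering_centers] yields the weak type estimate
    [mu {x in B | M f x > t} <= 2 C0^2 / t * int_(2B, |f| > t/2) |f|]
    ([weak_type_of_covering]).  Summing it over the dyadic levels [t = 2^k l]
    gives [int_B (M f)^p <= l^p m + const * int_(2B) |f|^p]
    ([integral_poweR_le_of_weak]).  Both terms have the order
    [N^p m ^ (1 - p/q)]: starting the summation at the level [l] costs no more
    than what the Morrey norm allows on [B].

    Measurability of [M_alpha f] holds because integrals over the open balls
    [ball x r] are lower semicontinuous in [x] and left-continuous in [r], so
    that the supremum over [r] may be restricted to rational radii
    ([measurable_frac_maximal]). *)

(** * Integrals, powers and level sets *)

(** For each [e > 0] only finitely many disjoint sets of measure at least [e] fit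
    into a set of finite measure; take [e = 1 / (n + 1)]. *)
Lemma countable_trivIset_measure d (T : measurableType d) (R : realType)
    (mu : {measure set T -> \bar R}) (I : choiceType) (D : set I)
    (F : I -> set T) (A : set T) :
  measurable A -> (mu A < +oo)%E ->
  (forall i, D i -> measurable (F i)) -> (forall i, D i -> F i `<=` A) ->
  (forall i, D i -> (0 < mu (F i))%E) -> trivIset D F -> countable D.
Proof.
move=> mA Afin mF FA F0 tF.
have finD (e : R) : 0 < e -> finite_set [set i | D i /\ (e%:E <= mu (F i))%E].
  move=> e0; apply: contrapT => infD.
  have muA0 := measure_ge0 mu A.
  have muAfin : mu A \is a fin_num by rewrite ge0_fin_numE.
  set n := (Num.truncn (fine (mu A) / e)).+1.
  have [B BD nB] := infinite_set_fset n infD.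
  have BD' i : i \in B -> D i by move=> /BD[].
  have : (\sum_(i <- B) mu (F i) <= mu A)%E.
    rewrite -measure_fbigsetU.
    - apply: le_measure => /=; last 1 first.
      + by rewrite -bigcup_fset => x [i /BD' /FA]; apply.
      + apply: mem_set; rewrite big_seq.
        by apply: bigsetU_measurable => i /BD'; exact: mF.
      + exact: mem_set.
    - by move=> i /BD' /mF.
    - by apply: sub_trivIset tF => i /BD'.
  apply/negP; rewrite -ltNge.
  apply: (@lt_le_trans _ _ (\sum_(i <- B) e%:E)%E); last first.
    rewrite big_seq [leRHS]big_seq; apply: lee_sum => i /BD[]//.
  rewrite sumEFin big_const_seq count_predT iter_addr_0 -mulr_natr.
  rewrite -(fineK muAfin) lte_fin mulrC -ltr_pdivrMr//.
  rewrite (lt_le_trans (Num.Theory.truncnS_gt _))// ler_nat//.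
have -> : D = \bigcup_n [set i | D i /\ (n.+1%:R^-1%:E <= mu (F i))%E].
  apply/seteqP; split => [i Di|i [n _ []]//].
  have : (0 < mu (F i))%E by exact: F0.
  case E : (mu (F i)) => [r| |] // r0; last by exists 0%N => //; split => //; rewrite E leey.
  rewrite lte_fin in r0.
  exists (Num.truncn (r^-1)) => //; split => //; rewrite E lee_fin.
  by rewrite invf_ple ?posrE// ltW// truncnS_gt.
by apply: bigcup_countable => // n _; apply/finite_set_countable/finD; rewrite invr_gt0.
Qed.

(** The part of [h] below [t / 2] contributes at most half of [t mu B]. *)
Lemma half_mean_le_truncated d (T : measurableType d) (R : realType)
    (mu : {measure set T -> \bar R}) (h : T -> \bar R) (B : set T) (t : R) :
  measurable B -> measurable_fun setT h -> (forall y, 0 <= h y)%E ->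
  0 < t -> (mu B < +oo)%E -> (t%:E * mu B < \int[mu]_(y in B) h y)%E ->
  ((t / 2)%:E * mu B <= \int[mu]_(y in B `&` [set y | (t / 2)%:E < h y]%E) h y)%E.
Proof.
move=> mB mh h0 t0 Bfin tB.
set H := [set y | _]; have mH : measurable (H : set T).
  by rewrite -[H]setTI; exact: emeasurable_fun_o_infty.
have mBH : measurable (B `&` H : set T) by exact: measurableI.
have mBD : measurable (B `\` H : set T) by exact: measurableD.
have mhD D : measurable_fun D h by exact: measurable_funS mh.
have low : (\int[mu]_(y in B `\` H) h y <= (t / 2)%:E * mu B)%E.
  apply: (@le_trans _ _ (\int[mu]_(y in B `\` H) cst (t / 2)%:E y)%E).
    apply: ge0_le_integral => // y [_ /negP]; by rewrite -leNgt.
  rewrite integral_cst//; apply: lee_wpmul2l; first by rewrite lee_fin; lra.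
  by apply: le_measure => [||y []//]; exact: mem_set.
have splitB : (\int[mu]_(y in B) h y =
    \int[mu]_(y in B `\` H) h y + \int[mu]_(y in B `&` H) h y)%E.
  have BU : B = (B `\` H) `|` (B `&` H) by rewrite -setDDr setDv setD0.
  rewrite {1}BU ge0_integral_setU//.
  - by apply/disj_setPS => y [[_ nH] [_ /nH]].
have muBE : mu B = (fine (mu B))%:E.
  by rewrite fineK// ge0_fin_numE.
rewrite -(@leeD2lE _ ((t / 2)%:E * mu B)); last by rewrite muBE.
apply: (@le_trans _ _ (\int[mu]_(y in B) h y)%E).
  rewrite (le_trans _ (ltW tB))// muBE -!EFinM -EFinD lee_fin; lra.
by rewrite splitB leeD2r.
Qed.

Lemma lt1_powR2 (R : realType) (e : R) : 0 < e -> 1 < 2 `^ e.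
Proof.
by move=> e0; have := @gt0_ltr_powR R e e0 1 2; rewrite powR1; apply;
  rewrite ?nnegrE// ltr1n.
Qed.

(** A geometric sum is comparable to its last term, here the last one below
    [y]. *)
Lemma geometric_truncated_sum_le (R : realType) (a b y : R) (n : nat) :
  0 <= a -> 1 < b -> 0 <= y ->
  \sum_(0 <= k < n) (if a * b ^+ k < y then a * b ^+ k else 0) <= b / (b - 1) * y.
Proof.
move=> a0 b1 y0; have b0 : 0 < b - 1 by rewrite subr_gt0.
rewrite -mulrAC ler_pdivlMr//.
have bn k : 0 <= a * b ^+ k by rewrite mulr_ge0// exprn_ge0//; lra.
have full m : (\sum_(0 <= k < m) (if a * b ^+ k < y then a * b ^+ k else 0)) * (b - 1)
    <= a * b ^+ m.
  elim: m => [|m IH]; first by rewrite big_geq// mul0r.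
  rewrite big_nat_recr//= mulrDl exprS; have := bn m.
  by case: ifP => _ ?; nra.
elim: n => [|n IH]; first by rewrite big_geq// mul0r; nra.
rewrite big_nat_recr//=; case: ifPn => [lty|_]; last by rewrite addr0.
by rewrite mulrDl; have := full n; nra.
Qed.

(** The term [k] with [2^k l < g <= 2^(k+1) l] already dominates [g^p]; values
    [g <= l] are absorbed by [l^p].  Starting at a positive level [l] makes this a
    series over [nat]. *)
Lemma poweR_le_dyadic_sum (R : realType) (g : \bar R) (p l : R) :
  0 < p -> 0 < l -> (0 <= g)%E ->
  (g `^ p <= (l `^ p)%:E + \sum_(0 <= k <oo)
     (if (2 ^+ k * l)%:E < g then ((2 ^+ k.+1 * l) `^ p)%:E else 0))%E.
Proof.
move=> p0 l0 g0.
set S := (\sum_(0 <= k <oo) _)%E.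
have t0 (k : nat) : (0 <= if (2 ^+ k * l)%:E < g then ((2 ^+ k.+1 * l) `^ p)%:E else 0)%E.
  by case: ifP => // _; rewrite lee_fin powR_ge0.
have S0 : (0 <= S)%E by exact: nneseries_ge0.
(* Stated for reals below g, so that it also covers g = +oo, where every term of
   the series is present. *)
have key (y : R) : 0 <= y -> (y%:E <= g)%E -> ((y `^ p)%:E <= (l `^ p)%:E + S)%E.
  move=> y0 yg; have [yl|ly] := leP y l.
    by rewrite (@le_trans _ _ (l `^ p)%:E) ?leeDl// lee_fin ge0_ler_powR ?nnegrE// ltW.
  have [n lt_n] : exists n, y <= 2 ^+ n * l.
    exists (Num.truncn (y / l)).+1; rewrite -ler_pdivrMr// ltW//.
    rewrite (lt_le_trans (Num.Theory.truncnS_gt _))// -natrX ler_nat.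
    by rewrite ltnW// ltn_expl.
  have /ex_minnP[m ym minm] : exists n, y <= 2 ^+ n * l by exists n.
  case: m ym minm => [|m] ym minm; first by move: ym; rewrite expr0 mul1r leNgt ly.
  have lm : 2 ^+ m * l < y by rewrite ltNge; apply/negP => /minm; rewrite ltnn.
  rewrite (@le_trans _ _ S)//; last by rewrite leeDr// lee_fin powR_ge0.
  apply: (@le_trans _ _ ((2 ^+ m.+1 * l) `^ p)%:E).
    rewrite lee_fin ge0_ler_powR ?nnegrE// ?(ltW p0)//.
    by rewrite mulr_ge0// ?exprn_ge0// ltW.
  apply: (@le_trans _ _ (\sum_(0 <= k < m.+1)
     (if (2 ^+ k * l)%:E < g then ((2 ^+ k.+1 * l) `^ p)%:E else 0))%E).
    rewrite big_nat_recr//= ifT ?leeDr ?sume_ge0//.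
    by rewrite (lt_le_trans _ yg)// lte_fin.
  exact: nneseries_lim_ge.
case: g g0 @S t0 S0 key => [r| |]// r0 S t0 S0 key; first by rewrite poweR_EFin key.
rewrite (_ : (_ + S)%E = +oo%E) ?leey//; apply: eq_infty => r.
have y0 : 0 <= (Num.max r 0) `^ p^-1 by exact: powR_ge0.
apply: le_trans (key _ y0 _); last exact: leey.
by rewrite lee_fin -powRrM mulVf ?gt_eqF// powRr1 ?le_max ?lexx ?orbT.
Qed.

Lemma dyadic_sum_le_poweR (R : realType) (h : \bar R) (p l : R) :
  1 < p -> 0 < l -> (0 <= h)%E ->
  (\sum_(0 <= k <oo)
     (if ((2 ^+ k * l) / 2)%:E < h then ((2 ^+ k * l) `^ (p - 1))%:E * h else 0)
   <= ((2 `^ (p - 1)) ^+ 2 / (2 `^ (p - 1) - 1))%:E * h `^ p)%E.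
Proof.
move=> p1 l0 h0; set b := 2 `^ (p - 1).
have b1 : 1 < b by rewrite lt1_powR2// subr_gt0.
have b10 : 0 < b - 1 by rewrite subr_gt0.
have c0 : 0 < b ^+ 2 / (b - 1) by rewrite divr_gt0// exprn_gt0//; lra.
case: h h0 => [r| |]// r0; last first.
  by rewrite poweRyr ?gt_eqF ?gt0_muley ?leey//; lra.
apply: lime_le.
  by apply: is_cvg_nneseries => k _ _; case: ifP => // _; rewrite mule_ge0 ?lee_fin ?powR_ge0.
apply: nearW => n.
rewrite poweR_EFin -EFinM.
rewrite lee_fin in r0.
have := @geometric_truncated_sum_le R (l `^ (p - 1)) b ((2 * r) `^ (p - 1)) n
  (powR_ge0 _ _) b1 (powR_ge0 _ _).
have term k : l `^ (p - 1) * b ^+ k = (2 ^+ k * l) `^ (p - 1).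
  rewrite mulrC powRM ?exprn_ge0// ?(ltW l0)//; congr (_ * _).
  by rewrite /b -powR_mulrn ?powR_ge0// -powR_mulrn// powRAC.
move=> /(ler_wpM2r r0); rewrite mulr_suml => H.
apply: (@le_trans _ _ (\sum_(0 <= k < n)
   (if l `^ (p - 1) * b ^+ k < (2 * r) `^ (p - 1) then l `^ (p - 1) * b ^+ k else 0) * r)%:E).
  rewrite -sumEFin; apply: lee_sum => k _.
  rewrite term lte_fin; case: ifP => [lt_r|_].
    rewrite ifT// gt0_ltr_powR ?nnegrE//; [lra| | lra|lra].
    by rewrite mulr_ge0// ?exprn_ge0// ltW.
  by case: ifP => _; rewrite ?mul0r// lee_fin mulr_ge0// powR_ge0.
rewrite lee_fin (le_trans H)//.
rewrite powRM// -/b -(@mulr_powRB1 _ r p)//; last lra.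
rewrite le_eqVlt; apply/orP; left; apply/eqP; field.
by rewrite gt_eqF.
Qed.

(** The factor [2^p] comes from comparing consecutive dyadic levels, the other one
    from [dyadic_sum_le_poweR]. *)
Definition dyadic_const (R : realType) (p : R) : R :=
  2 `^ p * ((2 `^ (p - 1)) ^+ 2 / (2 `^ (p - 1) - 1)).

Lemma dyadic_const_ge0 (R : realType) (p : R) : 1 < p -> 0 <= dyadic_const p.
Proof.
move=> p1; rewrite /dyadic_const mulr_ge0 ?powR_ge0// divr_ge0 ?exprn_ge0 ?powR_ge0//.
by rewrite subr_ge0 ltW// lt1_powR2// subr_gt0.
Qed.

(** Marcinkiewicz interpolation with the layer-cake formula replaced by a sum over
    the levels [2^k l]: only levels from [l] on enter, at the price of the term
    [l^p mu B]. *)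
Lemma integral_poweR_le_of_weak d (T : measurableType d) (R : realType)
    (mu : {measure set T -> \bar R}) (A B : set T) (g h : T -> \bar R)
    (p l K : R) :
  measurable A -> measurable B ->
  measurable_fun setT g -> measurable_fun setT h ->
  (forall x, 0 <= g x)%E -> (forall x, 0 <= h x)%E ->
  1 < p -> 0 < l -> 0 <= K ->
  (forall t, l <= t ->
    (mu (B `&` [set x | t%:E < g x]%E) <=
      (K / t)%:E * \int[mu]_(x in A `&` [set x | (t / 2)%:E < h x]%E) h x)%E) ->
  (\int[mu]_(x in B) (g x `^ p) <=
    (l `^ p)%:E * mu B + (K * dyadic_const p)%:E * \int[mu]_(x in A) (h x `^ p))%E.
Proof.
move=> mA mB mg mh g0 h0 p1 l0 K0 weak.
have p0 : 0 < p by lra.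
pose G k := [set x | (2 ^+ k * l)%:E < g x]%E.
pose H k := [set x | (2 ^+ k * l / 2)%:E < h x]%E.
have tk k : 0 < 2 ^+ k * l by rewrite mulr_gt0// exprn_gt0.
have mG k : measurable (G k).
  by rewrite -[G k]setTI; exact: emeasurable_fun_o_infty.
have mH k : measurable (H k).
  by rewrite -[H k]setTI; exact: emeasurable_fun_o_infty.
have mpow (f : T -> \bar R) D : measurable_fun setT f ->
    measurable_fun D (fun x => f x `^ p)%E.
  move=> mf; apply: (@measurable_funS _ _ _ _ setT) => //.
  by apply: (measurableT_comp (measurable_poweR p)).
pose u k x : \bar R := (((2 ^+ k.+1 * l) `^ p)%:E * (\1_(G k) x)%:E)%E.
have uE k x : u k x = (if (2 ^+ k * l)%:E < g x then ((2 ^+ k.+1 * l) `^ p)%:E else 0)%E.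
  rewrite /u indicE; case: ifPn => gx; first by rewrite mem_set// mule1.
  by rewrite memNset ?mule0//; exact/negP.
have mu_ k D : measurable_fun D (u k).
  by apply: measurable_funeM; apply/measurable_EFinP; exact: measurable_indic.
have u0 k x : (0 <= u k x)%E by rewrite uE; case: ifP => // _; rewrite lee_fin powR_ge0.
apply: (@le_trans _ _ (\int[mu]_(x in B) ((l `^ p)%:E + \sum_(0 <= k <oo) u k x))%E).
  apply: ge0_le_integral => //.
  - by move=> x _; exact: poweR_ge0.
  - exact: mpow.
  - apply: emeasurable_funD => //.
    by apply: ge0_emeasurable_sum => //.
  - move=> x _; under eq_eseriesr do rewrite uE.
    exact: poweR_le_dyadic_sum.
rewrite ge0_integralD//; last first.
- by apply: ge0_emeasurable_sum => //.
- by move=> x _; exact: nneseries_ge0.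
- by move=> x _; rewrite lee_fin powR_ge0.
rewrite integral_cst// leeD2l// integral_nneseries//.
pose v k x : \bar R := (if (2 ^+ k * l / 2)%:E < h x
  then ((2 ^+ k * l) `^ (p - 1))%:E * h x else 0)%E.
have vE k : v k = (fun x => ((2 ^+ k * l) `^ (p - 1))%:E * (h \_ (H k)) x)%E.
  apply/funext => x; rewrite /v patchE; case: ifPn => hx; first by rewrite mem_set.
  by rewrite memNset ?mule0//; exact/negP.
have mhH k D : measurable_fun D (h \_ (H k)).
  apply: (@measurable_funS _ _ _ _ setT) => //.
  by apply/(measurable_restrict h) => //; exact: measurable_funS mh.
have hH0 k x : (0 <= (h \_ (H k)) x)%E by rewrite patchE; case: ifP.
have mv k D : measurable_fun D (v k) by rewrite vE; exact: measurable_funeM.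
have v0 k x : (0 <= v k x)%E by rewrite vE mule_ge0 ?lee_fin ?powR_ge0.
apply: (@le_trans _ _ (\sum_(0 <= k <oo) (K * 2 `^ p)%:E * \int[mu]_(x in A) v k x)%E).
  apply: lee_nneseries => [k _ _|k _]; first exact: integral_ge0.
  rewrite ge0_integralZl_EFin ?powR_ge0//; last first.
  - by apply/measurable_EFinP; exact: measurable_indic.
  rewrite integral_indic// setIC.
  rewrite vE ge0_integralZl_EFin ?powR_ge0// -integral_mkcondr.
  rewrite muleA -EFinM.
  apply: le_trans (lee_wpmul2l _ (weak (2 ^+ k * l) _)) _.
  - by rewrite lee_fin powR_ge0.
  - by rewrite ler_peMl ?(ltW l0)// exprn_ege1//; lra.
  rewrite muleA -EFinM -/(H k) le_eqVlt; apply/orP; left; apply/eqP.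
  congr (_%:E * _)%E.
  rewrite exprS -mulrA powRM ?ltW// -(@mulr_powRB1 _ (2 ^+ k * l) p) ?ltW//.
  have := tk k; set t := 2 ^+ k * l => t0; field.
  by rewrite gt_eqF.
rewrite nneseriesZl; last by move=> k _; exact: integral_ge0.
rewrite -integral_nneseries// /dyadic_const mulrA (EFinM (K * _)) -[leRHS]muleA.
rewrite lee_wpmul2l ?lee_fin ?mulr_ge0 ?powR_ge0//.
rewrite -ge0_integralZl_EFin//; last 2 first.
- exact: mpow.
- rewrite divr_ge0 ?exprn_ge0 ?powR_ge0// subr_ge0 ltW//.
  by rewrite lt1_powR2// subr_gt0.
apply: ge0_le_integral => //.
- by move=> x _; exact: nneseries_ge0.
- by apply: ge0_emeasurable_sum => //.
- by apply: measurable_funeM; exact: mpow.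
- by move=> x _; exact: dyadic_sum_le_poweR.
by move=> x _; exact: poweR_ge0.
Qed.

(** Where [h > t] one has [h = h^p h^(1-p) <= h^p t^(1-p)]. *)
Lemma le_poweR_truncation (R : realType) (h : \bar R) (p t : R) :
  1 < p -> 0 < t -> (0 <= h)%E ->
  (h <= t%:E + (t `^ (1 - p))%:E * h `^ p)%E.
Proof.
move=> p1 t0; case: h => [r| |]// r0; last first.
  by rewrite poweRyr ?gt0_muley ?lte_fin ?powR_gt0//; lra.
rewrite lee_fin in r0; rewrite poweR_EFin -EFinM -EFinD lee_fin.
have [rt|tr] := leP r t; first by rewrite ler_wpDr// mulr_ge0 ?powR_ge0.
have r0' : 0 < r by rewrite (lt_trans t0).
apply: ler_wpDl; first exact: ltW.
rewrite -(@mulr_powRB1 _ r p)// ?(lt_trans _ p1)// mulrCA ler_peMr//.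
rewrite -(opprB p 1) powRN ler_pdivlMl ?powR_gt0// mulr1.
by rewrite ge0_ler_powR ?nnegrE//; lra.
Qed.

(** A substitute for Hoelder's inequality which also covers functions with
    infinite values: optimizing [t] gives the same bound up to the factor 2. *)
Lemma integral_le_poweR d (T : measurableType d) (R : realType)
    (mu : {measure set T -> \bar R}) (B : set T) (h : T -> \bar R) (p t : R) :
  measurable B -> measurable_fun setT h -> (forall y, 0 <= h y)%E ->
  1 < p -> 0 < t ->
  (\int[mu]_(y in B) h y <=
     t%:E * mu B + (t `^ (1 - p))%:E * \int[mu]_(y in B) (h y `^ p))%E.
Proof.
move=> mB mh h0 p1 t0.
have mhp : measurable_fun B (fun y => h y `^ p)%E.
  apply: (@measurable_funS _ _ _ _ setT) => //.
  exact: (measurableT_comp (measurable_poweR p)).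
have tp : (0 <= (t `^ (1 - p))%:E)%E by rewrite lee_fin powR_ge0.
rewrite -integral_cst// -ge0_integralZl_EFin ?powR_ge0//; last first.
  by move=> y _; exact: poweR_ge0.
rewrite -ge0_integralD//; last 3 first.
- by move=> y _; rewrite lee_fin ltW.
- by move=> y _; rewrite mule_ge0 ?poweR_ge0.
- exact: measurable_funeM.
apply: ge0_le_integral => //.
- exact: measurable_funS mh.
- by apply: emeasurable_funD => //; exact: measurable_funeM.
- by move=> y _; exact: le_poweR_truncation.
Qed.

Lemma ler_npowR (R : realType) (e a b : R) :
  e <= 0 -> 0 < a -> a <= b -> b `^ e <= a `^ e.
Proof.
move=> e0 a0 ab; rewrite -[e]opprK !(powRN _ (- e)).
rewrite lef_pV2 ?posrE ?powR_gt0 ?(lt_le_trans a0)//.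
by rewrite ge0_ler_powR ?nnegrE ?oppr_ge0 ?(ltW a0)// ltW// (lt_le_trans a0).
Qed.

(** * Vitali's covering lemma in a metric space *)

(** Call a disjoint subfamily good if every ball that meets it meets a member of at
    least half its radius.  Zorn's lemma gives a maximal good subfamily; if some
    balls missed it, one of nearly maximal radius among these could be added.  Only
    the centres have to be covered, hence the dilation factor 3. *)
Lemma vitali_covering_centers (R : realType) (X : metricType R) (E : set X)
    (s : X -> R) (r : R) :
  (forall x, E x -> 0 < s x <= r) ->
  exists D : set X, [/\ D `<=` E, trivIset D (fun x => ball x (s x)) &
    forall x, E x -> exists2 y, D y & ball y (3 * s y) x].
Proof.
move=> sE; pose B x := ball x (s x).
have Bx x : E x -> B x x by move=> /sE/andP[s0 _]; exact: ballxx.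
pose good (D : set X) := [/\ D `<=` E, trivIset D B &
  forall x y, E x -> D y -> B x `&` B y !=set0 ->
    exists2 z, D z & B x `&` B z !=set0 /\ s x <= 2 * s z].
have [D [[DE tD coverD] maxD]] : exists D, good D /\ forall D', D `<` D' -> ~ good D'.
  apply: Zorn_bigcup => F Fgood Ftot; split.
  - by move=> x [D /Fgood[DE _ _] Dx]; exact: DE.
  - move=> x y [D FD Dx] [D' FD' D'y]; have [DD'|D'D] := Ftot _ _ FD FD'.
      by have [_ tD _] := Fgood _ FD'; apply: tD => //; exact: DD'.
    by have [_ tD _] := Fgood _ FD; apply: tD => //; exact: D'D.
  - move=> x y Ex [D FD Dy] xy; have [_ _ coverD] := Fgood _ FD.
    by have [z Dz ?] := coverD _ _ Ex Dy xy; exists z => //; exists D.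
exists D; split => // x Ex.
have [[y [Dy xy]]|noD] := pselect (exists y, D y /\ B x `&` B y !=set0).
  have [z Dz [[w [xw zw]] sxz]] := coverD _ _ Ex Dy xy; exists z => //.
  apply: (@le_ball _ _ _ (s z + s x)); first lra.
  by apply: ball_triangle zw _; exact: ball_sym.
exfalso; pose U := [set x | E x /\ forall y, D y -> ~ (B x `&` B y !=set0)].
have Ux : U x by split => // y Dy xy; apply: noD; exists y.
have supU : has_sup (s @` U).
  split; first by exists (s x), x.
  by exists r => _ [y [/sE/andP[_ ?] _] <-].
have sup0 : 0 < sup (s @` U).
  have /sE/andP[sx0 _] := Ex.
  by rewrite (lt_le_trans sx0)//; apply: sup_upper_bound => //; exists x.
have [_ [x0 Ux0 <-]] := sup_adherent (divr_gt0 sup0 (ltr0n R 2)) supU.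
move=> lt_x0; have [Ex0 Dx0] := Ux0.
apply: (maxD (D `|` [set x0])).
  split; first by move=> y; left.
  move=> /(_ x0 (or_intror erefl)) Dx0'.
  by apply: (Dx0 _ Dx0'); exists x0; split; exact: Bx.
split.
- by move=> y [/DE//|->].
- move=> y z [Dy|->] [Dz|->] //.
  + exact: tD.
  + by rewrite setIC => /(Dx0 _ Dy).
  + by move=> /(Dx0 _ Dz).
- move=> y z Ey Dz yz.
  have [[w [Dw yw]]|noDy] := pselect (exists w, D w /\ B y `&` B w !=set0).
    by have [v Dv ?] := coverD _ _ Ey Dw yw; exists v => //; left.
  have Uy : U y by split => // w Dw yw; apply: noDy; exists w.
  exists x0; first by right.
  split; first by case: Dz yz => [Dz yz|-> //]; case: (Uy.2 z).
  have : s y <= sup (s @` U) by apply: sup_upper_bound => //; exists y.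
  lra.
Qed.

(** * Balls and measurability of maximal functions *)

Section MetricMeasureSpace.
Context (R : realType) (X : pmetricType R).

Lemma metric_ball_open (x : X) (r : R) : open (ball x r).
Proof.
rewrite openE => y xy; apply/nbhs_ballP.
have : mdist x y < r by move: xy; rewrite ballEmdist.
rewrite -subr_gt0 => r0; exists (r - mdist x y) => //= z yz.
move: yz; rewrite !ballEmdist/= => yz.
by rewrite (le_lt_trans (metric_triangle _ y _))// -ltrBrDl.
Qed.

Context (mu : {outer_measure set X -> \bar R}) (Xmu : metric_measure_space mu).
Local Notation T := (caratheodory_type mu).
Local Notation mu' := (mu : set T -> \bar R).

Lemma open_caratheodory (U : set X) : open U -> measurable (U : set T).
Proof.
by move=> oU; apply: (mms_borel_regular Xmu).1; exact: sub_sigma_algebra.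
Qed.

Lemma ball_caratheodory (x : X) (r : R) : measurable (ball x r : set T).
Proof. exact/open_caratheodory/metric_ball_open. Qed.

Lemma mu_ball_lty (x : X) (r : R) : (mu (ball x r) < +oo)%E.
Proof.
apply: (mms_bounded Xmu); exists (2 * r) => y z.
rewrite !ballEmdist/= => xy xz.
have := metric_triangle y x z; rewrite (metric_sym y x); lra.
Qed.

Lemma mu_ball_gt0 (x : X) (r : R) : 0 < r -> (0 < mu (ball x r))%E.
Proof.
move=> r0; apply: (mms_open Xmu); first exact: metric_ball_open.
by exists x; exact: ballxx.
Qed.

Lemma mu_ball_fine (x : X) (r : R) : 0 < r ->
  exists2 m : R, 0 < m & mu (ball x r) = m%:E.
Proof.
move=> r0; have := mu_ball_lty x r; have := mu_ball_gt0 x r0.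
by case: (mu (ball x r)) => // m; rewrite lte_fin => m0 _; exists m.
Qed.

(** Left-continuity in the radius: the open ball is the union of the smaller
    concentric ones. *)
Lemma ball_integral_left (h : T -> \bar R) (x : X) (r : R) (t : \bar R) :
  measurable_fun setT h -> (forall y, 0 <= h y)%E -> 0 < r ->
  (t < \int[mu']_(y in ball x r) h y)%E ->
  exists2 r', 0 < r' < r & (t < \int[mu']_(y in ball x r') h y)%E.
Proof.
move=> mh h0 r0 tr.
pose F (n : nat) : set T := ball x (r - r / n.+2%:R).
have F_nd : {homo F : n m / (n <= m)%N >-> (n <= m)%O}.
  move=> n m nm; apply/subsetPset; apply: le_ball.
  by rewrite lerD2l lerN2 ler_pM2l// lef_pV2 ?posrE// ler_nat.
have Fr : \bigcup_n F n = ball x r.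
  apply/seteqP; split => [y [n _]|y].
    by apply: le_ball; rewrite gerBl divr_ge0// ltW.
  rewrite ballEmdist/= => xy.
  have d0 : 0 < r - mdist x y by rewrite subr_gt0.
  exists (Num.truncn (r / (r - mdist x y))) => //.
  rewrite /F ballEmdist/= ltrBrDr -ltrBrDl ltr_pdivrMr// -ltr_pdivrMl// mulrC.
  by rewrite (lt_le_trans (Num.Theory.truncnS_gt _))// ler_nat.
have mF n : measurable (F n) by exact: ball_caratheodory.
have := @ge0_nondecreasing_set_cvg_integral _ _ _ _ h mu' F_nd mF
  (fun n => measurable_funS measurableT (@subsetT _ _) mh) (fun n y _ => h0 y).
rewrite Fr => cvgF.
have [n _ /(_ n (leqnn _)) /= tF] := cvgF _ (open_ereal_gt' tr).
exists (r - r / n.+2%:R) => //; rewrite subr_gt0 gtrBl divr_gt0// andbT.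
by rewrite ltr_pdivrMr// ltr_pMr// ltr1n.
Qed.

(** The superlevel sets are open: if the integral over [ball x r'] with [r' < r]
    already exceeds a level, so does the one over [ball y r] for [y] within
    [r - r'] of [x]. *)
Lemma measurable_ball_integral (h : T -> \bar R) (r : R) :
  measurable_fun setT h -> (forall y, 0 <= h y)%E -> 0 < r ->
  measurable_fun [set: T] (fun x : T => \int[mu']_(y in ball (x : X) r) h y)%E.
Proof.
move=> mh h0 r0.
apply: (measurability _ (ErealGenOInfty.measurableE R)) => _ [_ [a ->] <-].
rewrite setTI; apply: open_caratheodory; rewrite openE => x /=.
rewrite in_itv/= andbT => ax.
have [r' /andP[r'0 r'r] ar'] := ball_integral_left mh h0 r0 ax.
apply/nbhs_ballP; exists (r - r'); first by rewrite /= subr_gt0.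
move=> y xy /=; rewrite in_itv/= andbT (lt_le_trans ar')//.
apply: ge0_subset_integral => //.
- exact: ball_caratheodory.
- exact: ball_caratheodory.
- exact: measurable_funS mh.
- by move=> z xz; rewrite -(subrK r' r); apply: ball_triangle xz; exact: ball_sym.
Qed.

(** When the radius decreases to a nearby rational one, the factor
    [mu (ball x r) ^ (alpha - 1)] does not decrease, as [alpha <= 1], and the integral
    decreases by little: so rational radii give the same supremum. *)
Lemma measurable_frac_maximal (alpha : R) (f : T -> \bar R) :
  alpha <= 1 -> measurable_fun setT f ->
  measurable_fun setT (frac_maximal alpha f).
Proof.
move=> alpha1 mf.
have mabs : measurable_fun setT (fun y => `|f y|)%E by exact: measurableT_comp.
pose A (r : R) (x : T) := (mu' (ball (x : X) r) `^ (alpha - 1) *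
  \int[mu']_(y in ball (x : X) r) `|f y|)%E.
have mA r : 0 < r -> measurable_fun setT (A r).
  move=> r0; apply: emeasurable_funM; last exact: measurable_ball_integral.
  apply: (measurableT_comp (measurable_poweR _)).
  apply: (eq_measurable_fun (fun x : T => \int[mu']_(y in ball (x : X) r) cst 1 y)%E).
    by move=> x _; rewrite integral_cst ?mul1e//; exact: ball_caratheodory.
  by apply: measurable_ball_integral => // y; exact: lee01.
apply: (measurability _ (ErealGenOInfty.measurableE R)) => _ [_ [a ->] <-].
rewrite setTI.
pose F (q : rat) : set T :=
  if 0 < ratr q :> R then [set x | (a%:E < A (ratr q) x)%E] else set0.
have -> : frac_maximal alpha f @^-1` `]a%:E, +oo[%classic = \bigcup_q F q.
  apply/seteqP; split => [x|x [q _]] /=; rewrite in_itv/= andbT; last first.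
    rewrite /F; case: ifPn => // q0 /= aA; apply: (lt_le_trans aA).
    by apply: ereal_sup_ubound; exists (ratr q).
  move=> /ereal_sup_gt[_ [r r0 <-]] aA.
  have [m m0 mE] := mu_ball_fine x r0.
  rewrite mE poweR_EFin -lte_pdivrMl ?powR_gt0// in aA.
  have [r' /andP[r'0 r'r] aA'] := ball_integral_left mabs (fun y => abse_ge0 (f y)) r0 aA.
  have [q /itvP qE] := rat_in_itvoo r'r.
  have q0 : 0 < ratr q :> R by rewrite (lt_trans r'0)// qE.
  exists q => //; rewrite /F q0 /= /A.
  have [mq mq0 mqE] := mu_ball_fine x q0.
  have mqm : mq <= m.
    by rewrite -lee_fin -mE -mqE; apply/le_outer_measure/le_ball; rewrite qE.
  rewrite lte_pdivrMl ?powR_gt0// in aA'.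
  rewrite mqE poweR_EFin; apply: (lt_le_trans aA'); apply: lee_pmul.
  - by rewrite lee_fin powR_ge0.
  - by apply: integral_ge0 => y _; exact: abse_ge0.
  - by rewrite lee_fin ler_npowR// subr_le0.
  apply: ge0_subset_integral => //.
  - exact: ball_caratheodory.
  - exact: ball_caratheodory.
  - exact: measurable_funS mabs.
  - by apply: le_ball; rewrite qE.
apply: bigcupT_measurable_rat => q; rewrite /F; case: ifPn => // q0.
rewrite -[X in measurable X]setTI; apply: emeasurable_fun_o_infty => //; exact: mA.
Qed.

Lemma frac_maximal_ge0 (alpha : R) (f : T -> \bar R) (x : T) :
  (0 <= frac_maximal alpha f x)%E.
Proof.
apply: ereal_sup_ge; exists (mu' (ball (x : X) 1) `^ (alpha - 1) *
  \int[mu']_(y in ball (x : X) 1) `|f y|)%E; first by exists 1 => /=.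
by rewrite mule_ge0 ?poweR_ge0 ?integral_ge0.
Qed.

(** * Weak type estimate in a doubling space *)

Context (C0 : R) (C01 : 1 <= C0)
  (mudbl : forall (x : X) (r : R), 0 < r ->
     (mu (ball x (2 * r)) <= C0%:E * mu (ball x r))%E).

Lemma mu_ball_tripled (x : X) (r : R) : 0 < r ->
  (mu (ball x (3 * r)) <= (C0 ^+ 2)%:E * mu (ball x r))%E.
Proof.
move=> r0; apply: (@le_trans _ _ (mu (ball x (2 * (2 * r))))).
  by apply/le_outer_measure/le_ball; lra.
apply: (le_trans (mudbl _ _)); first by rewrite mulr_gt0.
rewrite expr2 EFinM -muleA; apply: lee_wpmul2l; last exact: mudbl.
by rewrite lee_fin (le_trans ler01).
Qed.

(** Vitali's lemma selects disjoint balls whose triples cover [E].  Doubling bounds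
    the measure of the triples by that of the balls, the choice of the balls bounds
    the latter by integrals of [h], and these add up by disjointness. *)
Lemma weak_type_of_covering (h : T -> \bar R) (E A : set T) (s : X -> R) (r t : R) :
  measurable A -> (mu A < +oo)%E ->
  measurable_fun setT h -> (forall y, 0 <= h y)%E -> 0 < t ->
  (forall x, E x -> [/\ 0 < s x <= r, ball (x : X) (s x) `<=` A &
    (t%:E * mu (ball (x : X) (s x)) < \int[mu']_(y in ball (x : X) (s x)) h y)%E]) ->
  (mu E <= (2 * C0 ^+ 2 / t)%:E *
     \int[mu']_(y in A `&` [set y | (t / 2)%:E < h y]%E) h y)%E.
Proof.
move=> mA Afin mh h0 t0 sE.
have [D [DE tD coverD]] :=
  @vitali_covering_centers R X E s r (fun x Ex => let: And3 H _ _ := sE x Ex in H).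
pose B (x : X) : set T := ball x (s x).
have s0 x : D x -> 0 < s x by move=> /DE/sE[/andP[]].
have mB x : measurable (B x) by exact: ball_caratheodory.
have BA x : D x -> B x `<=` A by move=> /DE/sE[].
have cD : countable D.
  apply: (@countable_trivIset_measure _ T R mu' X D B A) => //.
  by move=> x Dx; exact: mu_ball_gt0 (s0 _ Dx).
(* F enumerates the selected balls and G their triples, padded with set0 to
   families indexed by nat. *)
have [N NE] := countable_bijP _ cD.
have /card_set_bijP[c [cN cinj csurj]] : (N #= D)%card by rewrite card_eq_sym.
pose F (n : nat) : set T := if n \in N then B (c n) else set0.
pose H := [set y | (t / 2)%:E < h y]%E; have mH : measurable (H : set T).
  by rewrite -[H]setTI; exact: emeasurable_fun_o_infty.
have mF n : measurable (F n) by rewrite /F; case: ifP.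
have tF : trivIset setT F.
  apply/(trivIset_mkcond N (B \o c)) => i j Ni Nj /tD.
  move=> /(_ (cN _ Ni) (cN _ Nj)).
  by apply: cinj; exact: mem_set.
pose G (n : nat) : set X := if n \in N then ball (c n) (3 * s (c n)) else set0.
have EG : E `<=` \bigcup_n G n.
  move=> x /coverD[y /csurj[n Nn <-] yx]; exists n => //.
  by rewrite /G mem_set.
have k0 : 0 <= 2 * C0 ^+ 2 / t.
  by rewrite divr_ge0 ?mulr_ge0 ?exprn_ge0 ?(ltW t0)// (le_trans ler01).
apply: (@le_trans _ _ (\sum_(0 <= n <oo) mu (G n))%E).
  apply: (le_trans (le_outer_measure mu _ _ EG)).
  exact: outer_measure_sigma_subadditive.
apply: (@le_trans _ _ (\sum_(0 <= n <oo)
    (2 * C0 ^+ 2 / t)%:E * \int[mu']_(y in F n `&` H) h y)%E).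
  apply: lee_nneseries => n _; rewrite ?outer_measure_ge0// /G /F.
  case: ifPn => [/set_mem Nn|_]; last first.
    by rewrite outer_measure0 set0I integral_set0 mule0.
  have /sE[/andP[sn0 _] _ hn] : E (c n) by exact/DE/cN.
  apply: (le_trans (mu_ball_tripled _ sn0)).
  have := @half_mean_le_truncated _ T R mu' h _ t (mB (c n)) mh h0 t0 (mu_ball_lty _ _) hn.
  rewrite -/H => /(lee_wpmul2l (_ : 0 <= (2 * C0 ^+ 2 / t)%:E)%E).
  rewrite lee_fin => /(_ k0); apply: le_trans.
  rewrite muleA -EFinM le_eqVlt; apply/orP; left; apply/eqP; congr (_%:E * _)%E.
  by field; rewrite gt_eqF.
rewrite nneseriesZl; last by move=> n _; exact: integral_ge0.
apply: lee_wpmul2l; first by rewrite lee_fin.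
rewrite -ge0_integral_bigcup//; last 3 first.
- by move=> n; exact: measurableI.
- exact: measurable_funS mh.
- by apply: trivIset_setIr.
apply: ge0_subset_integral => //.
- by apply: bigcup_measurable => n _; exact: measurableI.
- exact: measurableI.
- exact: measurable_funS mh.
- move=> y [n _ []]; rewrite /F; case: ifPn => // /set_mem Nn yn Hy; split => //.
  by apply: BA yn; exact/cN.
Qed.

Definition maximal_const (p : R) : R :=
  (2 * C0) `^ p + 2 * C0 ^+ 2 * dyadic_const p * C0.

Lemma maximal_const_gt0 (p : R) : 1 < p -> 0 < maximal_const p.
Proof.
move=> p1; have C00 : 0 < C0 by rewrite (lt_le_trans ltr01).
rewrite ltr_pwDl ?powR_gt0 ?mulr_gt0// mulr_ge0 ?(ltW C00)//.
by apply: mulr_ge0 (dyadic_const_ge0 p1); apply: mulr_ge0 => //; exact/exprn_ge0/ltW.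
Qed.

(** * Maximal functions of Morrey functions *)

Section MorreyBound.
Context (p q N : R) (p1 : 1 < p) (pq : p <= q) (N0 : 0 < N).
Context (f : T -> \bar R) (mf : measurable_fun setT f)
  (fN : (morrey_norm p q f <= N%:E)%E).

Let q0 : 0 < q. Proof. by rewrite (lt_le_trans _ pq)// (lt_trans _ p1). Qed.
Let p0 : 0 < p. Proof. by rewrite (lt_trans _ p1). Qed.
Let mabsf : measurable_fun setT (fun y => `|f y|)%E.
Proof. exact: measurableT_comp. Qed.

Lemma morrey_integral_le (x : X) (r m : R) :
  0 < r -> mu (ball x r) = m%:E ->
  (\int[mu']_(y in ball x r) (`|f y| `^ p) <= (N `^ p * m `^ (1 - p / q))%:E)%E.
Proof.
move=> r0 mE; have m0 : 0 < m by rewrite -lte_fin -mE; exact: mu_ball_gt0.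
have : (m%:E `^ (q^-1 - p^-1) *
    (\int[mu']_(y in ball x r) (`|f y| `^ p)) `^ (p^-1) <= N%:E)%E.
  rewrite -mE; apply: le_trans fN; apply: ereal_sup_ubound.
  by exists (ball x r) => //; exists x, r.
set I := (\int[mu']_(y in _) _)%E.
have I0 : (0 <= I)%E by apply: integral_ge0 => y _; exact: poweR_ge0.
rewrite poweR_EFin -lee_pdivlMl ?powR_gt0// -EFinM => IN.
have := @gt0_ler_poweR R p (ltW p0) (I `^ p^-1)%E _ _ _ IN.
rewrite -poweRrM mulVf ?gt_eqF// poweRe1// poweR_EFin => /(_ _ _)/le_trans; apply.
- by rewrite in_itv/= poweR_ge0 leey.
- by rewrite in_itv/= lee_fin mulr_ge0 ?invr_ge0 ?powR_ge0 ?leey// ltW.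
rewrite lee_fin powRM ?invr_ge0 ?powR_ge0 ?(ltW N0)// mulrC.
rewrite -powRN -powRrM le_eqVlt; apply/orP; left; apply/eqP.
by congr (_ * _ `^ _); field; rewrite !gt_eqF.
Qed.

(** Truncating at the height [t = N m ^ (- 1/q)] balances both terms of
    [integral_le_poweR]. *)
Lemma morrey_mean_le (x : X) (r m : R) :
  0 < r -> mu (ball x r) = m%:E ->
  (\int[mu']_(y in ball x r) `|f y| <= (2 * N * m `^ (1 - q^-1))%:E)%E.
Proof.
move=> r0 mE; have m0 : 0 < m by rewrite -lte_fin -mE; exact: mu_ball_gt0.
pose t := N * m `^ (- q^-1).
have t0 : 0 < t by rewrite mulr_gt0// powR_gt0.
have mB := ball_caratheodory x r.
have := @integral_le_poweR _ T R mu' (ball x r) _ p t mB mabsf (fun y => abse_ge0 (f y)) p1 t0.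
move=> /le_trans; apply.
apply: (@le_trans _ _ ((t * m)%:E + (t `^ (1 - p))%:E * (N `^ p * m `^ (1 - p / q))%:E)%E).
  rewrite (EFinM t m) -mE leeD2l//; apply: lee_wpmul2l; first by rewrite lee_fin powR_ge0.
  exact: morrey_integral_le.
rewrite -EFinM -EFinD lee_fin le_eqVlt; apply/orP; left; apply/eqP.
have -> : t * m = N * m `^ (1 - q^-1).
  rewrite /t -mulrA -{2}(powRr1 (ltW m0)) -powRD ?(gt_eqF m0) ?implybT//.
  by rewrite addrC.
have -> : t `^ (1 - p) * (N `^ p * m `^ (1 - p / q)) = N * m `^ (1 - q^-1).
  rewrite /t powRM ?powR_ge0 ?(ltW N0)// mulrACA -powRD ?(gt_eqF N0) ?implybT//.
  rewrite -powRrM -powRD ?(gt_eqF m0) ?implybT//.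
  rewrite subrK powRr1 ?(ltW N0)//; congr (_ * _ `^ _).
  by field; rewrite gt_eqF.
by ring.
Qed.

(** Bounds the means over balls that are centred in a ball of measure [m] and are
    larger than it. *)
Let far_bound (m : R) := 2 * C0 * N * m `^ (- q^-1).

(** If [r < s] then [ball x0 r] lies in [ball x (2 * s)], so that by doubling
    [m <= C0 mu (ball x s)] and the mean over [ball x s] is at most
    [far_bound m]. *)
Lemma large_mean_radius_le (x0 x : X) (r s t m : R) : 0 < r -> 0 < s ->
  mu (ball x0 r) = m%:E -> ball x0 r x -> far_bound m <= t ->
  (t%:E * mu (ball x s) < \int[mu']_(y in ball x s) `|f y|)%E -> s <= r.
Proof.
move=> r0 s0 mE xr lt; rewrite leNgt; apply: contraTN => rs; rewrite -leNgt.
have [ms ms0 msE] := mu_ball_fine x s0.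
have m0 : 0 < m by rewrite -lte_fin -mE; exact: mu_ball_gt0.
have C00 : 0 < C0 by rewrite (lt_le_trans ltr01).
have mms : m / C0 <= ms.
  rewrite ler_pdivrMr// mulrC -lee_fin EFinM -mE -msE.
  apply: (le_trans _ (mudbl x s0)); apply: le_outer_measure => y yr.
  apply: (@le_ball _ _ _ (r + r)); first lra.
  by apply: ball_triangle yr; exact: ball_sym.
apply: (le_trans (morrey_mean_le s0 msE)).
rewrite msE -EFinM lee_fin.
apply: (@le_trans _ _ (far_bound m * ms)); last by rewrite ler_wpM2r// ltW.
rewrite powRD ?(gt_eqF ms0) ?implybT// powRr1 ?(ltW ms0)// mulrCA mulrC.
rewrite ler_wpM2r ?(ltW ms0)// /far_bound -!mulrA ler_wpM2l// [leRHS]mulrCA ler_wpM2l ?(ltW N0)//.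
apply: (@le_trans _ _ ((m / C0) `^ (- q^-1))).
  by rewrite ler_npowR ?divr_gt0// oppr_le0 invr_ge0 ltW.
rewrite powRM ?invr_ge0 ?(ltW m0) ?(ltW C00)// mulrC ler_wpM2r ?powR_ge0//.
rewrite -(@powR_inv1 _ C0) ?(ltW C00)// -powRrM mulN1r opprK.
rewrite ler1_powR// invf_le1// (le_trans _ pq)// ltW//.
Qed.

(** The estimate of the Hardy-Littlewood operator on the Morrey space.  The two
    summands of [maximal_const] stem from the threshold [far_bound m] and from the
    integral over [ball x0 (2 * r)]. *)
Lemma maximal_poweR_integral_le (x0 : X) (r m : R) :
  0 < r -> mu (ball x0 r) = m%:E ->
  (\int[mu']_(y in ball x0 r) (frac_maximal 0 f y `^ p) <=
     (maximal_const p * (N `^ p * m `^ (1 - p / q)))%:E)%E.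
Proof.
move=> r0 mE; have m0 : 0 < m by rewrite -lte_fin -mE; exact: mu_ball_gt0.
have C00 : 0 < C0 by rewrite (lt_le_trans ltr01).
have l0 : 0 < far_bound m by rewrite /far_bound !mulr_gt0// powR_gt0.
have weak (t : R) : far_bound m <= t ->
    (mu' (ball x0 r `&` [set x | t%:E < frac_maximal 0 f x]%E) <=
    (2 * C0 ^+ 2 / t)%:E * \int[mu']_(x in ball x0 (2 * r) `&`
      [set x | (t / 2)%:E < `|f x|]%E) `|f x|)%E.
  move=> lt; have t0 := lt_le_trans l0 lt.
  set E := _ `&` _.
  have [s sP] : {s : X -> R & forall x, E x -> 0 < s x /\
      (t%:E * mu (ball x (s x)) < \int[mu']_(y in ball x (s x)) `|f y|)%E}.
    apply: (@choice _ _ (fun x s => E x -> 0 < s /\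
      (t%:E * mu (ball x s) < \int[mu']_(y in ball x s) `|f y|)%E)) => x.
    have [[_ /ereal_sup_gt[_ [s s0 <-]] ts]|nE] := pselect (E x); last by exists 0.
    exists s => _; split => //; have [ms ms0 msE] := mu_ball_fine x s0.
    rewrite msE poweR_EFin sub0r powR_inv1 ?(ltW ms0)// in ts.
    rewrite msE muleC -lte_pdivlMl//.
  apply: (@weak_type_of_covering (fun y => `|f y|%E) E (ball x0 (2 * r)) s r t) => //.
  - exact: ball_caratheodory.
  - exact: mu_ball_lty.
  - move=> x Ex; have [s0 ts] := sP x Ex; have [xr _] := Ex.
    have sr := large_mean_radius_le r0 s0 mE xr lt ts.
    split => //; first by rewrite s0.
    move=> y xy; apply: (@le_ball _ _ _ (r + s x)); first lra.
    exact: ball_triangle xr xy.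
have := @integral_poweR_le_of_weak _ T R mu' (ball x0 (2 * r)) (ball x0 r)
  (frac_maximal 0 f) (fun y => `|f y|%E) p (far_bound m) (2 * C0 ^+ 2)
  (ball_caratheodory _ _) (ball_caratheodory _ _)
  (measurable_frac_maximal ler01 mf) mabsf (frac_maximal_ge0 0 f) (fun y => abse_ge0 (f y)) p1 l0
  (mulr_ge0 (ler0n _ _) (exprn_ge0 _ (ltW C00))) weak.
move=> /le_trans; apply.
have r20 : 0 < 2 * r by rewrite mulr_gt0.
have [m2 m20 m2E] := mu_ball_fine x0 r20.
have m2m : m2 <= C0 * m.
  by rewrite -lee_fin EFinM -mE -m2E; exact: mudbl.
have K0 : 0 <= 2 * C0 ^+ 2 * dyadic_const p.
  by apply: mulr_ge0 (dyadic_const_ge0 p1); apply: mulr_ge0 => //; exact/exprn_ge0/ltW.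
apply: (@le_trans _ _ ((far_bound m `^ p * m)%:E + (2 * C0 ^+ 2 * dyadic_const p)%:E *
   (N `^ p * m2 `^ (1 - p / q))%:E)%E).
  rewrite (EFinM _ m) -mE leeD2l//; apply: lee_wpmul2l; first by rewrite lee_fin.
  exact: morrey_integral_le.
rewrite -EFinM -EFinD lee_fin /maximal_const [leRHS]mulrDl lerD//.
  rewrite le_eqVlt; apply/orP; left; apply/eqP; rewrite /far_bound.
  rewrite powRM ?powR_ge0 ?mulr_ge0 ?(ltW C00) ?(ltW N0)//.
  rewrite powRM ?mulr_ge0 ?(ltW C00) ?(ltW N0)// -!mulrA; congr (_ * (_ * _)).
  rewrite -powRrM -{2}(powRr1 (ltW m0)) -powRD ?(gt_eqF m0) ?implybT//.
  by congr (_ `^ _); ring.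
have pq1 : 0 <= 1 - p / q by rewrite subr_ge0 ler_pdivrMr// mul1r.
rewrite -[leRHS]mulrA ler_wpM2l// mulrCA ler_wpM2l ?powR_ge0//.
apply: (@le_trans _ _ ((C0 * m) `^ (1 - p / q))).
  by rewrite ge0_ler_powR ?nnegrE ?mulr_ge0 ?(ltW C00) ?(ltW m0) ?(ltW m20).
rewrite powRM ?(ltW C00) ?(ltW m0)// ler_wpM2r ?powR_ge0// ler1_powR//.
by rewrite gerBl divr_ge0// ltW.
Qed.

(** Hedberg's inequality for Morrey functions: each fractional mean is a geometric
    average of the mean and of the quantity [m ^ (1/q - 1) I] controlled by
    [morrey_mean_le]. *)
Lemma frac_maximal_le_maximal (alpha : R) (x : X) :
  0 <= alpha -> alpha * q < 1 ->
  (frac_maximal alpha f x <=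
     ((2 * N) `^ (alpha * q))%:E * frac_maximal 0 f x `^ (1 - alpha * q))%E.
Proof.
move=> alpha0 aq1; have aq0 : 0 <= alpha * q by rewrite mulr_ge0// ltW.
have theta0 : 0 <= 1 - alpha * q by rewrite subr_ge0 ltW.
apply: ge_ereal_sup => _ [r r0 <-].
have [m m0 mE] := mu_ball_fine x r0.
have := morrey_mean_le r0 mE.
have : (mu' (ball x r) `^ (0 - 1) * \int[mu']_(y in ball x r) `|f y| <= frac_maximal 0 f x)%E.
  by apply: ereal_sup_ubound; exists r.
have : (0 <= \int[mu']_(y in ball x r) `|f y|)%E by exact: integral_ge0.
rewrite mE !poweR_EFin.
case: (\int[mu']_(y in ball x r) `|f y|)%E => // I; rewrite !lee_fin => I0 IM IN.
rewrite -EFinM in IM.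
have I1 : I = I `^ (1 - alpha * q) * I `^ (alpha * q).
  by rewrite -powRD subrK ?powRr1// oner_eq0.
apply: (@le_trans _ _ (((2 * N) `^ (alpha * q))%:E *
    (m `^ (0 - 1) * I)%:E `^ (1 - alpha * q))%E).
  rewrite poweR_EFin -!EFinM lee_fin.
  rewrite {1}I1 (powRM (1 - alpha * q) (powR_ge0 m (0 - 1)) I0) -(powRrM m (0 - 1)).
  have -> : m `^ (alpha - 1) =
      m `^ ((0 - 1) * (1 - alpha * q)) * (m `^ (q^-1 - 1)) `^ (alpha * q).
    rewrite -powRrM -powRD ?(gt_eqF m0) ?implybT//; congr (_ `^ _).
    by field; rewrite gt_eqF.
  rewrite mulrACA mulrC ler_wpM2r ?mulr_ge0 ?powR_ge0// -powRM ?powR_ge0//.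
  rewrite ge0_ler_powR ?nnegrE ?mulr_ge0 ?powR_ge0 ?(ltW N0) ?(ltW q0)//.
    rewrite -(opprB 1 q^-1) powRN ler_pdivrMl ?powR_gt0//.
  by rewrite mulrC.
apply: lee_wpmul2l; first by rewrite lee_fin powR_ge0.
have mI0 : (0 <= (m `^ (0 - 1) * I)%:E)%E by rewrite lee_fin mulr_ge0 ?powR_ge0.
by apply: gt0_ler_poweR => //; rewrite in_itv/= ?leey ?andbT// (le_trans mI0).
Qed.

Lemma morrey_norm_frac_maximal_le (alpha : R) :
  0 <= alpha -> alpha * q < 1 ->
  (morrey_norm (p / (1 - alpha * q)) (q / (1 - alpha * q)) (frac_maximal alpha f)
   <= (2 `^ (alpha * q) * maximal_const p `^ ((1 - alpha * q) / p) * N)%:E)%E.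
Proof.
move=> alpha0 aq1; have aq0 : 0 <= alpha * q by rewrite mulr_ge0// ltW.
have alpha1 : alpha <= 1.
  by rewrite (le_trans _ (ltW aq1))// ler_peMr// (le_trans _ pq)// ltW.
set theta := 1 - alpha * q; have theta0 : 0 < theta by rewrite subr_gt0.
apply: ge_ereal_sup => _ [_ [x [r r0 ->]] <-].
have [m m0 mE] := mu_ball_fine x r0.
have K0 : 0 <= maximal_const p by rewrite ltW// maximal_const_gt0.
pose a := (2 * N) `^ (alpha * q * (p / theta)).
have a0 : 0 <= a by exact: powR_ge0.
have mMp : measurable_fun setT (fun y => frac_maximal 0 f y `^ p)%E.
  by apply: (measurableT_comp (measurable_poweR p)); exact: measurable_frac_maximal.
have intM : (\int[mu']_(y in ball x r) (`|frac_maximal alpha f y| `^ (p / theta)) <=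
    (a * (maximal_const p * (N `^ p * m `^ (1 - p / q))))%:E)%E.
  rewrite EFinM; apply: le_trans (lee_wpmul2l _ (maximal_poweR_integral_le r0 mE)); last first.
    by rewrite lee_fin.
  rewrite -ge0_integralZl_EFin//; last 3 first.
  - exact: ball_caratheodory.
  - by move=> y _; exact: poweR_ge0.
  - exact: measurable_funS mMp.
  apply: ge0_le_integral.
  - exact: ball_caratheodory.
  - by move=> y _; exact: poweR_ge0.
  - apply: (@measurable_funS _ _ _ _ setT) => //.
    apply: (measurableT_comp (measurable_poweR _)).
    by apply: measurableT_comp => //; exact: measurable_frac_maximal.
  - by apply: measurable_funeM; exact: measurable_funS mMp.
  - move=> y _; rewrite gee0_abs ?frac_maximal_ge0//.
    have := @gt0_ler_poweR R (p / theta) (divr_ge0 (ltW p0) (ltW theta0))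
      _ _ _ _ (frac_maximal_le_maximal y alpha0 aq1).
    rewrite poweRM ?lee_fin ?powR_ge0 ?poweR_ge0// poweR_EFin -powRrM -poweRrM.
    rewrite -/theta (_ : theta * (p / theta) = p); last by field; rewrite gt_eqF.
    apply; rewrite in_itv/= leey andbT ?frac_maximal_ge0//.
    by rewrite mule_ge0 ?lee_fin ?powR_ge0 ?poweR_ge0.
set J := (\int[mu']_(y in _) _)%E in intM *.
have J0 : (0 <= J)%E by apply: integral_ge0 => y _; exact: poweR_ge0.
rewrite mE poweR_EFin.
have e0 : 0 <= (p / theta)^-1 by rewrite invr_ge0 divr_ge0 ?ltW.
have mN0 : 0 <= N `^ p * m `^ (1 - p / q) by rewrite mulr_ge0 ?powR_ge0.
have aK0 : 0 <= a * (maximal_const p * (N `^ p * m `^ (1 - p / q))).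
  by rewrite mulr_ge0// mulr_ge0.
apply: (@le_trans _ _ ((m `^ ((q / theta)^-1 - (p / theta)^-1))%:E *
   (a * (maximal_const p * (N `^ p * m `^ (1 - p / q))))%:E `^ (p / theta)^-1)%E).
  apply: lee_wpmul2l; first by rewrite lee_fin powR_ge0.
  by apply: gt0_ler_poweR => //; rewrite in_itv/= ?leey ?andbT// lee_fin.
rewrite poweR_EFin -EFinM lee_fin le_eqVlt; apply/orP; left; apply/eqP.
rewrite (powRM _ a0 (mulr_ge0 K0 mN0)) (powRM _ K0 mN0) powRM ?powR_ge0//.
rewrite /a -!powRrM.
have -> : alpha * q * (p / theta) * (p / theta)^-1 = alpha * q.
  by field; rewrite !gt_eqF.
have -> : p * (p / theta)^-1 = theta by field; rewrite !gt_eqF.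
have -> : (p / theta)^-1 = theta / p by field; rewrite !gt_eqF.
have -> : (1 - p / q) * (theta / p) = - ((q / theta)^-1 - theta / p).
  by field; rewrite !gt_eqF.
rewrite powRN powRM ?(ltW N0)//.
set b := m `^ _; have b0 : b != 0 by rewrite gt_eqF// powR_gt0.
have NE : N `^ (alpha * q) * N `^ theta = N.
  rewrite -powRD ?(gt_eqF N0) ?implybT// /theta addrC subrK powRr1//.
  exact: ltW.
rewrite -[in RHS]NE; field; exact: b0.
Qed.

End MorreyBound.
End MetricMeasureSpace.

Theorem corollary5p11 (R : realType) (X : pmetricType R)
    (mu : {outer_measure set X -> \bar R}) (p q alpha : R)
    (Xmu : metric_measure_space mu) (mudbl : doubling mu)
    (p1 : 1 < p) (pq : p <= q) (alpha0 : 0 <= alpha) (alphaq : alpha < 1 / q) :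
  let pt := p / (1 - alpha * q) in
  let qt := q / (1 - alpha * q) in
  exists C : R, 0 < C /\
    forall f : caratheodory_type mu -> \bar R, morrey_space p q f ->
      morrey_space pt qt (frac_maximal alpha f) /\
      (morrey_norm pt qt (frac_maximal alpha f) <= C%:E * morrey_norm p q f)%E.
Proof.
move=> pt qt; have [C0 [C01 dbl]] := mudbl.
have q0 : 0 < q by rewrite (lt_le_trans _ pq)// (lt_trans _ p1).
have aq1 : alpha * q < 1 by rewrite -ltr_pdivlMr.
have alpha1 : alpha <= 1.
  by rewrite (le_trans _ (ltW aq1))// ler_peMr// (le_trans _ pq)// ltW.
have K0 : 0 < maximal_const C0 p by exact: maximal_const_gt0.
set C := 2 `^ (alpha * q) * maximal_const C0 p `^ ((1 - alpha * q) / p).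
have Cpos : 0 < C by rewrite mulr_gt0// powR_gt0.
exists C; split => // f [mf fN].
have N0 : (0 <= morrey_norm p q f)%E.
  apply: ereal_sup_ge; eexists; first by exists (ball point 1) => //; exists point, 1.
  by rewrite mule_ge0 ?poweR_ge0.
have bound : (morrey_norm pt qt (frac_maximal alpha f) <= C%:E * morrey_norm p q f)%E.
  move: fN N0; case E : (morrey_norm p q f) => [N| |]// _; rewrite lee_fin => N0.
  (* The estimates need a positive bound on the norm of f, hence the e of room. *)
  apply/lee_addgt0Pr => e e0.
  have Ne : 0 < N + e / C by rewrite ltr_wpDl// divr_gt0.
  have fNe : (morrey_norm p q f <= (N + e / C)%:E)%E.
    by rewrite E lee_fin lerDl divr_ge0 ?ltW.
  apply: (le_trans (morrey_norm_frac_maximal_le Xmu C01 dbl p1 pq Ne mf fNe alpha0 aq1)).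
  rewrite -EFinM -EFinD lee_fin -/C le_eqVlt; apply/orP; left; apply/eqP.
  by field; rewrite gt_eqF.
split => //; split; first exact: measurable_frac_maximal.
apply: (le_lt_trans bound); rewrite lte_mul_pinfty//.
by rewrite lee_fin ltW.
Qed.
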